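(* Let $\mathcal{T} = \langle \mathcal{S},\mathcal{A},p,r,\gamma,\beta,\pi_0\rangle$ be an entropy-regularized task with optimal action-value function $Q^*$, optimal state-value function $V^*$ and optimal policy $\pi^*$. Let $\widetilde{\mathcal{T}} = \langle \mathcal{S},\mathcal{A},p,\widetilde{r},\gamma,\beta,\pi_0\rangle$ be a task differing from $\mathcal{T}$ only in its reward function, with optimal action-value function $\widetilde{Q}^*$, optimal state-value function $\widetilde{V}^*$ and optimal policy $\widetilde{\pi}^*$. Define $\kappa(s,a,s') = \widetilde{r}(s,a,s') - r(s,a,s')$. Let $K^*$ be the optimal action-value function solving the Bellman optimality equation $$K^{*}(s,a) = \mathbb{E}_{s' \sim p(\cdot\mid s,a)}\left[ \kappa(s,a,s') + \frac{\gamma}{\beta} \log \mathbb{E}_{a' \sim \pi^*(\cdot\mid s')} e^{\beta K^{*}(s',a')} \right],$$ with corresponding state-value function $$V_K^*(s) = \frac{1}{\beta}\log \sum_a \pi^*(a\mid s)e^{\beta K^*(s,a)}$$ and corresponding optimal policy $$\pi_K^*(a\mid s) = \frac{\pi^*(a\mid s)e^{\beta K^*(s,a)}}{e^{\beta V_K^*(s)}}.$$ Then for all $s\in\mathcal{S}$, $a\in\mathcal{A}$: $$\widetilde{Q}^*(s,a) = Q^*(s,a) + K^*(s,a),\qquad \widetilde{V}^*(s) = V^*(s) + V_K^*(s),\qquad \widetilde{\pi}^*(a\mid s) = \pi^*_K(a\mid s).$$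
   Context: An entropy-regularized task $\langle \mathcal{S},\mathcal{A},p,r,\gamma,\beta,\pi_0\rangle$ consists of discrete (finite or countable) state and action sets $\mathcal{S},\mathcal{A}$, transition dynamics $p(s'\mid s,a)$ (a probability distribution over $s'$ for each $(s,a)$), a bounded reward function $r\colon \mathcal{S}\times\mathcal{A}\times\mathcal{S}\to\mathbb{R}$, a discount factor $\gamma\in(0,1)$, an inverse temperature $\beta>0$, and a prior policy $\pi_0\colon\mathcal{S}\times\mathcal{A}\to(0,1)$ (for each $s$, $\pi_0(\cdot\mid s)$ is a probability distribution on $\mathcal{A}$). The optimal action-value function $Q^*$ of the task is the (unique) bounded solution of the soft Bellman optimality equation $$Q^*(s,a) = \mathbb{E}_{s'\sim p(\cdot\mid s,a)}\left[r(s,a,s') + \frac{\gamma}{\beta}\log \mathbb{E}_{a'\sim\pi_0(\cdot\mid s')} e^{\beta Q^*(s',a')}\right].$$ The optimal state-value function is $V^*(s)=\frac{1}{\beta}\log\sum_a\pi_0(a\mid s)e^{\beta Q^*(s,a)}$, and the optimal policy is $\pi^*(a\mid s)=\pi_0(a\mid s)e^{\beta Q^*(s,a)}/\sum_{a'}\pi_0(a'\mid s)e^{\beta Q^*(s,a')}$. Thus $K^*$, $V_K^*$, $\pi_K^*$ are the optimal quantities of the task with reward $\kappa$ and prior policy $\pi^*$ (same $p,\gamma,\beta$); $K^*$ denotes the bounded solution of its equation. *)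

(* Defs.v *)
(* MathComp-Analysis, over an arbitrary R : realType. *)
From HB Require Import structures.
From mathcomp Require Import all_boot all_order all_algebra.
From mathcomp Require Import all_classical all_reals all_analysis.

Set Implicit Arguments.
Unset Strict Implicit.
Unset Printing Implicit Defensive.
Import Order.TTheory GRing.Theory Num.Theory.
Local Open Scope classical_set_scope.
Local Open Scope ring_scope.

Section Discrete.
Variables (R : realType) (T : countType).

(* \esum only handles nonnegative terms, hence the split into positive and
   negative parts.  For an absolutely summable family this is its sum; the
   value is junk otherwise. *)
Definition dsum (f : T -> R) : R :=
  fine (\esum_(x in [set: T]) (EFin \o f)^\+%E x
        - \esum_(x in [set: T]) (EFin \o f)^\-%E x)%E.

Definition is_pmf (m : T -> R) : Prop :=
  (forall x, 0 <= m x) /\ (\esum_(x in [set: T]) (m x)%:E = 1%:E)%E.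

Definition dexpect (m f : T -> R) : R := dsum (fun x => m x * f x).

End Discrete.

(* Only the data of a task; its axioms are in [valid_task].
   [trans t s a s'] is p(s' | s, a) and [prior t s a] is pi_0(a | s). *)
Record task (R : realType) (S A : countType) := Task {
  trans : S -> A -> S -> R;
  reward : S -> A -> S -> R;
  discount : R;
  invtemp : R;
  prior : S -> A -> R
}.

Section SoftControl.
Variables (R : realType) (S A : countType).
Implicit Types (t : task R S A) (Q : S -> A -> R).

Definition valid_task t : Prop :=
  [/\ forall s a, is_pmf (trans t s a),
      exists M : R, forall s a s', `|reward t s a s'| <= M,
      0 < discount t < 1,
      0 < invtemp t
    & forall s, is_pmf (prior t s) /\ (forall a, 0 < prior t s a < 1)].

Definition soft_bellman t Q : Prop :=
  forall s a,
    Q s a = dexpect (trans t s a) (fun s' =>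
      reward t s a s' + discount t / invtemp t *
        ln (dexpect (prior t s') (fun a' => expR (invtemp t * Q s' a')))).

(* Among bounded functions the soft Bellman equation of a valid task has
   exactly one solution, so this characterizes the optimal action values. *)
Definition optimal_Q t Q : Prop :=
  (exists M : R, forall s a, `|Q s a| <= M) /\ soft_bellman t Q.

(* In the next two definitions Q is meant to satisfy [optimal_Q t]. *)
Definition optimal_V t Q (s : S) : R :=
  1 / invtemp t * ln (dsum (fun a => prior t s a * expR (invtemp t * Q s a))).

Definition optimal_policy t Q (s : S) (a : A) : R :=
  prior t s a * expR (invtemp t * Q s a)
  / dsum (fun a' => prior t s a' * expR (invtemp t * Q s a')).

End SoftControl.

(* Main.v *)
(* With Z s = E_{pi0(.|s)} e^(beta Q) and W s = E_{pi0(.|s)} e^(beta (Q + K)),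
   the definition of the optimal policy gives
   E_{pi*(.|s)} e^(beta K) = W s / Z s.
   Adding the Bellman equations of Q and K, the two ln (Z s) terms cancel, so
   Q + K solves the Bellman equation of the task with reward rt.  That equation
   has only one bounded solution, since log-sum-exp is nonexpansive for the sup
   norm and hence two solutions at distance D are at distance at most gamma D. *)
Require Import Defs.
From mathcomp Require Import all_boot all_order all_algebra.
From mathcomp Require Import all_classical all_reals all_analysis.
From mathcomp Require Import ring lra.
Set Implicit Arguments.
Unset Strict Implicit.
Unset Printing Implicit Defensive.
Import Order.TTheory GRing.Theory Num.Theory.
Local Open Scope ring_scope.

(** * Extended sums of nonnegative families *)

Section Esum.
Context {R : realType} {T : choiceType}.
Local Open Scope ereal_scope.

(** Scaling by [c >= 0] commutes with each finite partial sum and with the supremum of these; the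
    empty partial sum shows that the supremum is over a nonempty set. *)
Lemma esumZl (D : set T) (c : R) (f : T -> \bar R) :
  (0 <= c)%R -> (forall x, 0 <= f x) ->
  \esum_(x in D) (c%:E * f x) = c%:E * \esum_(x in D) f x.
Proof.
move=> c0 f0; rewrite /esum -ereal_supZl //.
  congr ereal_sup; apply/seteqP; split=> [_ [F FD <-]|_ [_ [F FD <-] <-]] /=.
    by exists (\sum_(x \in F) f x); [exists F|rewrite ge0_mule_fsumr].
  by exists F => //; rewrite ge0_mule_fsumr.
apply/set0P; exists (\sum_(x \in set0) f x); exists set0 => //.
exact: fsets_set0.
Qed.

End Esum.

(** * Real sums and expectations over a countable type *)

Section DiscreteSum.
Context {R : realType} {T : countType}.
Implicit Types (f g m : T -> R) (c D M N : R).

Local Notation summ f := (summable [set: T] (EFin \o f)).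

Lemma dsum_ge0E f : (forall x, 0 <= f x) ->
  dsum f = fine (\esum_(x in [set: T]) (f x)%:E)%E.
Proof.
move=> f0; rewrite /dsum [X in (_ - X)%E]esum1 ?sube0; last first.
  by move=> x _; rewrite funenegE/= -EFin_max max_r// oppr_le0.
by congr fine; apply: eq_esum => x _; rewrite funeposE/= -EFin_max max_l.
Qed.

Lemma dsum_ge0 f : (forall x, 0 <= f x) -> 0 <= dsum f.
Proof.
by move=> f0; rewrite dsum_ge0E// fine_ge0// esum_ge0// => x _; rewrite lee_fin.
Qed.

Lemma ge0_dsumZl c f : 0 <= c -> (forall x, 0 <= f x) ->
  dsum (fun x => c * f x) = c * dsum f.
Proof.
move=> c0 f0; rewrite !dsum_ge0E// => [|x]; last exact: mulr_ge0.
under eq_esum do rewrite EFinM.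
(* If the sum is infinite, [fine] sends it to 0, and [c] times it is 0 or infinite, so both sides
   are 0. *)
rewrite esumZl//; case: esum => [r //||] /=.
  by rewrite mulr0 mulry; case: (sgrP c); rewrite ?mul0e ?mul1e ?mulN1e.
by rewrite mulr0 mulrNy; case: (sgrP c); rewrite ?mul0e ?mul1e ?mulN1e.
Qed.

Lemma dsumD f g : summ f -> summ g ->
  dsum (fun x => f x + g x) = dsum f + dsum g.
Proof.
move=> sf sg; pose F := (EFin \o f); pose G := (EFin \o g).
have fp := summable_funepos sf; have fn := summable_funeneg sf.
have gp := summable_funepos sg; have gn := summable_funeneg sg.
have fin (u : T -> \bar R) : (forall x, 0 <= u x)%E -> summable [set: T] u ->
    \esum_(x in [set: T]) u x \is a fin_num.
  by move=> u0; rewrite summableE; under eq_esum do rewrite gee0_abs//.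
(* These two families are in general not the positive and negative parts of [f + g], but [esumB]
   gives the same value for any difference of nonnegative summable families. *)
have -> : dsum (fun x => f x + g x) =
    fine (\esum_(x in [set: T]) (F^\+ \+ G^\+)%E x
        - \esum_(x in [set: T]) (F^\- \+ G^\-)%E x)%E.
  rewrite /dsum -(@esumB _ _ _ (F^\+ \+ G^\+)%E (F^\- \+ G^\-)%E);
    [|exact: (summableD fp gp)|exact: (summableD fn gn)
     |by move=> x _; exact: adde_ge0|by move=> x _; exact: adde_ge0].
  have -> // : (EFin \o (fun x => f x + g x)) =
      ((F^\+ \+ G^\+) \- (F^\- \+ G^\-))%E.
  apply/funext => x /=; rewrite /F /G !funeposE !funenegE /= -!EFin_max -!EFinD.
  by congr EFin; rewrite /Num.max; repeat case: ifPn => //; lra.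
rewrite !esumD// /dsum -/F -/G.
have := fin _ (funepos_ge0 F) fp; have := fin _ (funeneg_ge0 F) fn.
have := fin _ (funepos_ge0 G) gp; have := fin _ (funeneg_ge0 G) gn.
move=> /fineK <- /fineK <- /fineK <- /fineK <- /=.
lra.
Qed.

Lemma le_dsum f g : summ f -> summ g -> (forall x, f x <= g x) ->
  dsum f <= dsum g.
Proof.
move=> sf sg fg; have -> : g = (fun x => f x + (g x - f x)).
  by apply/funext => x; rewrite addrC subrK.
rewrite dsumD ?lerDl ?dsum_ge0// => [x|]; first by rewrite subr_ge0.
exact: (summableB sg sf).
Qed.

Lemma summable_pmfM m f M : is_pmf m -> (forall x, `|f x| <= M) ->
  summ (fun x => m x * f x).
Proof.
move=> [m0 m1] fM.
(* A point of [T] is what forces [0 <= M]; over an empty type the sum is empty. *)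
have [[z _]|T0] := pselect (exists x : T, True); last first.
  rewrite /summable esum1 ?ltry// => x; by case: T0; exists x.
have M0 : 0 <= M := le_trans (normr_ge0 _) (fM z).
apply: (@le_lt_trans _ _ (\esum_(x in [set: T]) (M%:E * (m x)%:E))%E).
  apply: le_esum => y _; rewrite /= lee_fin normrM ger0_norm// mulrC.
  exact: ler_wpM2r.
by rewrite esumZl// m1 mule1 ltry.
Qed.

Lemma dexpectD m f g M N : is_pmf m ->
  (forall x, `|f x| <= M) -> (forall x, `|g x| <= N) ->
  dexpect m (fun x => f x + g x) = dexpect m f + dexpect m g.
Proof.
move=> mp fM gN; rewrite /dexpect -dsumD;
  [|exact: summable_pmfM fM|exact: summable_pmfM gN].
by congr dsum; apply/funext => x; rewrite mulrDr.
Qed.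

Lemma ge0_dexpectZl m c f : is_pmf m -> 0 <= c -> (forall x, 0 <= f x) ->
  dexpect m (fun x => c * f x) = c * dexpect m f.
Proof.
move=> [m0 _] c0 f0; rewrite /dexpect -ge0_dsumZl//.
  by congr dsum; apply/funext => x; rewrite mulrCA.
by move=> x; exact: mulr_ge0.
Qed.

Lemma le_dexpect m f g M N : is_pmf m ->
  (forall x, `|f x| <= M) -> (forall x, `|g x| <= N) ->
  (forall x, f x <= g x) -> dexpect m f <= dexpect m g.
Proof.
move=> mp fM gN fg; apply: le_dsum;
  [exact: summable_pmfM fM|exact: summable_pmfM gN|].
by move=> x; rewrite ler_wpM2l//; case: mp.
Qed.

Lemma dexpect1 m : is_pmf m -> dexpect m (fun=> 1) = 1.
Proof.
move=> [m0 m1]; rewrite /dexpect dsum_ge0E => [|x]; rewrite ?mulr1//.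
by under eq_esum do rewrite mulr1; rewrite m1.
Qed.

Lemma dexpect_cst m c : is_pmf m -> 0 <= c -> dexpect m (fun=> c) = c.
Proof.
move=> mp c0; have := @ge0_dexpectZl m c (fun=> 1) mp c0 (fun=> ler01).
by under [X in dexpect m X = _ -> _]eq_fun do rewrite mulr1;
  rewrite dexpect1// mulr1.
Qed.

(** The pointwise bound [f <= D + g] survives averaging, since a constant is its own average;
    exchanging [f] and [g] gives the other inequality. *)
Lemma dexpect_lipschitz m f g M N D : is_pmf m -> 0 <= D ->
  (forall x, `|f x| <= M) -> (forall x, `|g x| <= N) ->
  (forall x, `|f x - g x| <= D) -> `|dexpect m f - dexpect m g| <= D.
Proof.
move=> mp D0; wlog suff : f g M N / (forall x, `|f x| <= M) ->
    (forall x, `|g x| <= N) -> (forall x, `|f x - g x| <= D) ->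
    dexpect m f <= D + dexpect m g.
  move=> H fM gN fg; rewrite ler_distl lerBlDl; apply/andP; split.
    by apply: H fM _ => // x; rewrite distrC.
  by rewrite addrC; exact: H fM gN fg.
move=> fM gN fg; rewrite -[X in X + _](dexpect_cst mp D0).
have nD (x : T) : `|D| <= D by rewrite ger0_norm.
rewrite -(dexpectD mp nD gN).
apply: (@le_dexpect _ _ _ M (D + N)) => // x.
  by rewrite (le_trans (ler_normD _ _))// lerD// (nD x).
by rewrite -lerBlDr (le_trans (ler_norm _)).
Qed.

(** * Log-sum-exp of bounded functions *)

Lemma dexpect_expR_gt0 m f M : is_pmf m -> (forall x, `|f x| <= M) ->
  0 < dexpect m (fun x => expR (f x)).
Proof.
move=> mp fM; apply: (@lt_le_trans _ _ (expR (- M))); first exact: expR_gt0.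
rewrite -[X in X <= _](dexpect_cst mp (expR_ge0 _)).
apply: (@le_dexpect _ _ _ (expR (- M)) (expR M)) => // x.
- by rewrite ger0_norm ?expR_ge0.
- by rewrite ger0_norm ?expR_ge0// ler_expR (le_trans (ler_norm _)).
- by rewrite ler_expR; have := fM x; rewrite ler_norml => /andP[].
Qed.

(* Pointwise [e^f <= e^D e^g]; integrate and take logarithms. *)
Lemma ln_dexpect_lipschitz m f g M N D : is_pmf m ->
  (forall x, `|f x| <= M) -> (forall x, `|g x| <= N) ->
  (forall x, `|f x - g x| <= D) ->
  `|ln (dexpect m (fun x => expR (f x))) -
    ln (dexpect m (fun x => expR (g x)))| <= D.
Proof.
move=> mp; wlog suff : f g M N / (forall x, `|f x| <= M) ->
    (forall x, `|g x| <= N) -> (forall x, `|f x - g x| <= D) ->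
    ln (dexpect m (fun x => expR (f x))) <=
      D + ln (dexpect m (fun x => expR (g x))).
  move=> H fM gN fg; rewrite ler_distl lerBlDl; apply/andP; split.
    by apply: H gN fM _ => x; rewrite distrC.
  by rewrite addrC; exact: H fM gN fg.
move=> fM gN fg.
rewrite -[X in X + _]expRK -lnM ?posrE ?expR_gt0 ?(dexpect_expR_gt0 mp gN)//.
rewrite ler_ln ?posrE ?mulr_gt0 ?expR_gt0 ?(dexpect_expR_gt0 mp gN)
  ?(dexpect_expR_gt0 mp fM)//.
rewrite -ge0_dexpectZl ?expR_ge0//.
apply: (@le_dexpect _ _ _ (expR M) (expR (D + N))) => // x.
- by rewrite ger0_norm ?expR_ge0// ler_expR (le_trans (ler_norm _)).
- rewrite -expRD ger0_norm ?expR_ge0// ler_expR lerD2l.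
  by rewrite (le_trans (ler_norm _)).
- by rewrite -expRD ler_expR -lerBlDr (le_trans (ler_norm _)).
Qed.

(** Compare [f] with the zero function, whose log-sum-exp is [ln 1 = 0]. *)
Lemma ln_dexpect_bound m f M : is_pmf m -> (forall x, `|f x| <= M) ->
  `|ln (dexpect m (fun x => expR (f x)))| <= M.
Proof.
move=> mp fM.
have := @ln_dexpect_lipschitz m f (fun=> 0) M 0 M mp fM.
under [X in _ - ln (dexpect m X)]eq_fun do rewrite expR0.
rewrite dexpect1// ln1 subr0; apply=> x; first by rewrite normr0.
by rewrite subr0.
Qed.

End DiscreteSum.

(** * Uniqueness for the soft Bellman equation, and change of prior *)

Section SoftBellman.
Context {R : realType} {S A : countType}.
Implicit Types (t : task R S A) (Q : S -> A -> R).

Lemma invtemp_bound t Q M : valid_task t -> (forall s a, `|Q s a| <= M) ->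
  forall s a, `|invtemp t * Q s a| <= invtemp t * M.
Proof.
by move=> [_ _ _ b0 _] QM s a; rewrite normrM gtr0_norm// ler_pM2l.
Qed.

(** The rewards cancel in the difference of the two right-hand sides. Log-sum-exp is applied to
    [invtemp t * Q], so it moves by at most [invtemp t * D], and the factor [discount t / invtemp t]
    leaves [discount t * D]. *)
Lemma soft_bellman_contraction t Q1 Q2 D : valid_task t ->
  optimal_Q t Q1 -> optimal_Q t Q2 -> 0 <= D ->
  (forall s a, `|Q1 s a - Q2 s a| <= D) ->
  forall s a, `|Q1 s a - Q2 s a| <= discount t * D.
Proof.
move=> vt [[M1 Q1M] E1] [[M2 Q2M] E2] D0 QD s a.
have B1 := invtemp_bound vt Q1M; have B2 := invtemp_bound vt Q2M.
move: vt => [tp [Mr rM] /andP[g0 g1] b0 pp].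
have c0 : 0 < discount t / invtemp t by rewrite divr_gt0.
have mp s' : is_pmf (prior t s') by case: (pp s').
rewrite E1 E2.
have bnd Q M : (forall s a, `|invtemp t * Q s a| <= invtemp t * M) ->
    forall s', `|reward t s a s' + discount t / invtemp t *
      ln (dexpect (prior t s') (fun a' => expR (invtemp t * Q s' a')))|
    <= Mr + discount t / invtemp t * (invtemp t * M).
  move=> B s'; rewrite (le_trans (ler_normD _ _))// lerD//.
  by rewrite normrM gtr0_norm// ler_pM2l// ln_dexpect_bound.
apply: (dexpect_lipschitz (tp s a) _ (bnd _ _ B1) (bnd _ _ B2)) => [|s'].
  by rewrite mulr_ge0// ltW.
rewrite opprD addrACA subrr add0r -mulrBr normrM gtr0_norm//.
have -> : discount t * D = discount t / invtemp t * (invtemp t * D).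
  by rewrite mulrA divfK// gt_eqF.
rewrite ler_pM2l//; apply: ln_dexpect_lipschitz (B1 s') (B2 s') _ => // a'.
by rewrite -mulrBr normrM gtr0_norm// ler_pM2l.
Qed.

Lemma optimal_Q_unique t Q1 Q2 : valid_task t ->
  optimal_Q t Q1 -> optimal_Q t Q2 -> Q1 = Q2.
Proof.
(* Fixing a pair [(s, a)] first makes the set [E] below nonempty, so that [sup E] is a genuine
   supremum. *)
move=> vt o1 o2; apply/funext => s; apply/funext => a.
have [[M1 Q1M] _] := o1; have [[M2 Q2M] _] := o2.
pose d (x : S * A) := `|Q1 x.1 x.2 - Q2 x.1 x.2|.
pose E := range d.
have Eub : has_ubound E.
  exists (M1 + M2) => _ [x _ <-]; rewrite (le_trans (ler_normB _ _))//.
  exact: lerD.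
have dE x : d x <= sup E by apply: ub_le_sup => //; exists x.
have supE0 : 0 <= sup E by apply: le_trans (dE (s, a)); exact: normr_ge0.
have [_ _ /andP[g0 g1] _ _] := vt.
(* The contraction is used with [D := sup E]; as [discount t < 1], a number at most [discount t]
   times itself cannot be positive. *)
have : sup E <= discount t * sup E.
  apply: ge_sup => [|_ [[s' a'] _ <-]]; first by exists (d (s, a)), (s, a).
  by apply: soft_bellman_contraction => // ? ?; exact: (dE (_, _)).
move=> supE_le; have supE : sup E <= 0 by nra.
apply/eqP; rewrite -subr_eq0 -normr_le0.
exact: le_trans (dE (s, a)) supE.
Qed.

(** The normalizer of the policy is positive and independent of the action, so it leaves the sum,
    and the two exponentials merge. Sums weighted by the optimal policy thus reduce to expectations
    under [prior t]. *)
Lemma dsum_optimal_policy t Q (K : S -> A -> R) s : valid_task t ->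
  (exists M, forall s a, `|Q s a| <= M) ->
  dsum (fun a => optimal_policy t Q s a * expR (invtemp t * K s a)) =
  dexpect (prior t s) (fun a => expR (invtemp t * (Q s a + K s a))) /
  dexpect (prior t s) (fun a => expR (invtemp t * Q s a)).
Proof.
move=> vt [M QM]; have B := invtemp_bound vt QM.
have [_ _ _ _ /(_ s)[mp _]] := vt; have [m0 _] := mp.
have Z0 := dexpect_expR_gt0 mp (B s).
rewrite mulrC -ge0_dsumZl ?invr_ge0 ?(ltW Z0)//; last first.
  by move=> a; rewrite mulr_ge0 ?expR_ge0.
congr dsum; apply/funext => a; rewrite /optimal_policy mulrDr expRD.
by rewrite -/(dexpect _ _); ring.
Qed.

End SoftBellman.

(** * Composition of the optimal quantities under a change of reward *)

Theorem theorem1 (R : realType) (S A : countType)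
    (p : S -> A -> S -> R) (r rt : S -> A -> S -> R) (gamma beta : R)
    (pi0 : S -> A -> R) (Q Qt K : S -> A -> R) :
  let T := Task p r gamma beta pi0 in
  let Tt := Task p rt gamma beta pi0 in
  let V := optimal_V T Q in
  let Vt := optimal_V Tt Qt in
  let piS := optimal_policy T Q in
  let pit := optimal_policy Tt Qt in
  let kappa := fun s a s' => rt s a s' - r s a s' in
  let TK := Task p kappa gamma beta piS in
  let VK := optimal_V TK K in
  let piK := fun s a => piS s a * expR (beta * K s a) / expR (beta * VK s) in
  valid_task T -> valid_task Tt ->
  optimal_Q T Q -> optimal_Q Tt Qt -> optimal_Q TK K ->
  forall s a,
    [/\ Qt s a = Q s a + K s a,
        Vt s = V s + VK s
      & pit s a = piK s a].
Proof.
move=> T Tt V Vt piS pit kappa TK VK piK vT vTt oQ oQt oK.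
have [[M QM] EQ] := oQ; have [[N KN] EK] := oK.
have QKMN s a : `|Q s a + K s a| <= M + N.
  by rewrite (le_trans (ler_normD _ _))// lerD.
have BQ := invtemp_bound vT QM; have BW := invtemp_bound vT QKMN.
rewrite /= in BQ BW.
have [/= tp [Mr rM] /andP[g0 g1] b0 pp] := vT; have [_ [Mt rtM] _ _ _] := vTt.
rewrite /= in rM rtM.
have mp s : is_pmf (pi0 s) by case: (pp s).
pose Z s := dexpect (pi0 s) (fun a => expR (beta * Q s a)).
pose W s := dexpect (pi0 s) (fun a => expR (beta * (Q s a + K s a))).
have Z0 s : 0 < Z s := dexpect_expR_gt0 (mp s) (BQ s).
have W0 s : 0 < W s := dexpect_expR_gt0 (mp s) (BW s).
have WZ s : dsum (fun a => piS s a * expR (beta * K s a)) = W s / Z s.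
  by apply: (dsum_optimal_policy K s vT); exists M.
have lnWZ s : ln (W s / Z s) = ln (W s) - ln (Z s) by rewrite ln_div ?posrE.
have oQK : optimal_Q Tt (fun s a => Q s a + K s a).
  split; first by exists (M + N).
  have c0 : 0 < gamma / beta by rewrite divr_gt0.
  have lnZ s : `|ln (Z s)| <= beta * M := ln_dexpect_bound (mp s) (BQ s).
  have lnW s : `|ln (W s)| <= beta * (M + N) := ln_dexpect_bound (mp s) (BW s).
  move=> s a; rewrite EQ EK /=.
  under [X in _ + dexpect _ X]eq_fun do rewrite /dexpect WZ lnWZ.
  (* The constants bound the integrands [r + gamma / beta * ln Z] and
     [kappa + gamma / beta * (ln W - ln Z)], using [|kappa| <= Mt + Mr]. In their sum
     [r + kappa = rt] and only [ln W] remains. *)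
  rewrite -(@dexpectD _ _ _ _ _ (Mr + gamma / beta * (beta * M))
      (Mt + Mr + gamma / beta * (beta * (M + N) + beta * M)))//.
  - by congr dexpect; apply/funext => s'; rewrite -/(Z s') -/(W s') /kappa; ring.
  - move=> s'; rewrite (le_trans (ler_normD _ _))// lerD//.
    by rewrite normrM gtr0_norm// ler_pM2l// lnZ.
  - move=> s'; rewrite (le_trans (ler_normD _ _))// lerD//.
      by rewrite (le_trans (ler_normB _ _))// lerD.
    rewrite normrM gtr0_norm// ler_pM2l// (le_trans (ler_normB _ _))//.
    by rewrite lerD.
have QtE := optimal_Q_unique vTt oQt oQK.
have VKE s : VK s = 1 / beta * ln (W s / Z s) by rewrite /VK /optimal_V /= WZ.
move=> s a; rewrite /Vt /V /pit /piK VKE /optimal_V /piS /optimal_policy QtE /=.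
rewrite -![dsum _]/(dexpect _ _) -/(W s) -/(Z s); split=> //.
  by rewrite lnWZ; ring.
(* Here [expR (beta * VK s)] becomes [W s / Z s]; its [Z s] cancels the normalizer of [piS], leaving
   the weight [pi0 s a * expR (beta * (Q s a + K s a))] over [W s]. *)
rewrite div1r mulVKf ?gt_eqF// lnK ?posrE ?divr_gt0//.
rewrite mulrDr expRD; field.
by rewrite !gt_eqF.
Qed.
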